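(* Let $X$ and $Y$ be ordered normed spaces with the following properties: (1) The cone $X_+$ is total and normal, and every extremal vector $x$ of $X_+$ is also extremal in the bidual cone $X''_+$ (where $X$ is identified with its canonical image in $X''$). (2) The cone $Y_+$ is total. For non-zero vectors $x \in X_+$ and $y' \in Y'_+$, the functional $y' \otimes x \in \mathcal{C}(X,Y)'_+$ is extremal in $\mathcal{C}(X,Y)'_+$ if and only if $x$ is extremal in $X_+$ and $y'$ is extremal in $Y'_+$.
   Context: All vector spaces are real. A wedge in a real vector space $V$ is a non-empty subset $V_+$ with $\alpha V_+ + \beta V_+ \subseteq V_+$ for all real $\alpha,\beta \ge 0$; it is a cone if in addition $V_+ \cap (-V_+) = \{0\}$. One writes $x \le y$ if $y - x \in V_+$, and $[v_1,v_2] = \{x \in V : v_1 \le x \le v_2\}$. A vector $v \in V_+$ is called extremal in $V_+$ (an extremal vector of $V_+$) if all elements of $[0,v]$ are scalar multiples of $v$. An ordered normed space is a normed space $X$ (not necessarily complete) endowed with a norm closed cone $X_+$. The cone $X_+$ is total if its linear span is norm dense in $X$. It is normal if there is a real number $C>0$ such that $0 \le x_1 \le x_2$ implies $\|x_1\| \le C\|x_2\|$ for all $x_1,x_2\in X$. The norm dual $X'$ is endowed with the dual wedge $X'_+ = \{x' \in X' : \langle x', x\rangle \ge 0 \text{ for all } x \in X_+\}$; the bidual $X'' = (X')'$ is endowed with $X''_+ = \{x'' \in X'' : \langle x'', x'\rangle \ge 0 \text{ for all } x' \in X'_+\}$. $\mathcal{L}(X,Y)$ is the space of bounded linear operators from $X$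 to $Y$ with the operator norm, and $\mathcal{L}(X,Y)_+ = \{T \in \mathcal{L}(X,Y): T[X_+] \subseteq Y_+\}$. $\mathcal{C}(X,Y)$ is the operator norm closure in $\mathcal{L}(X,Y)$ of the subspace of bounded finite rank operators, with $\mathcal{C}(X,Y)_+ = \mathcal{C}(X,Y) \cap \mathcal{L}(X,Y)_+$; its norm dual $\mathcal{C}(X,Y)'$ is endowed with the dual wedge $\mathcal{C}(X,Y)'_+$ of functionals that are non-negative on $\mathcal{C}(X,Y)_+$. For $x \in X$ and $y' \in Y'$, the functional $y' \otimes x \in \mathcal{C}(X,Y)'$ is given by $\langle y' \otimes x, T\rangle = \langle y', Tx\rangle$ for $T \in \mathcal{C}(X,Y)$. *)

(* Defs.v *)
From HB Require Import structures.
From mathcomp Require Import all_boot all_order all_algebra.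
From mathcomp Require Import all_classical all_reals all_analysis.

Set Implicit Arguments.
Unset Strict Implicit.
Unset Printing Implicit Defensive.

Import Order.TTheory GRing.Theory Num.Theory.
Import numFieldNormedType.Exports.

Local Open Scope classical_set_scope.
Local Open Scope ring_scope.

Section wedges.
Context {R : realType} {V : lmodType R}.
Implicit Types P A B : set V.

Definition is_wedge P :=
  P !=set0 /\
  forall (a b : R) (x y : V), 0 <= a -> 0 <= b -> P x -> P y ->
    P (a *: x + b *: y).

Definition is_cone P := is_wedge P /\ P `&` [set - x | x in P] = [set 0].

Definition wedge_le P (x y : V) := P (y - x).

Definition order_interval P (v1 v2 : V) : set V :=
  [set x | wedge_le P v1 x /\ wedge_le P x v2].

Definition extremal P (v : V) :=
  P v /\ forall x, order_interval P 0 v x -> exists a : R, x = a *: v.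

Definition linear_span A : set V :=
  [set v | exists (n : nat) (c : 'I_n -> R) (a : 'I_n -> V),
     (forall i, A (a i)) /\ v = \sum_(i < n) c i *: a i].

Lemma linear_span0 A : linear_span A 0.
Proof.
exists 0%N, (fun=> 0), (fun=> 0); split; first by case.
by rewrite big_ord0.
Qed.

Lemma linear_spanS A B : A `<=` B -> linear_span A `<=` linear_span B.
Proof.
by move=> AB v [n [c [a [Aa ->]]]]; exists n, c, a; split => // i; exact: AB.
Qed.

Lemma linear_spanP A (k : R) u v :
  linear_span A u -> linear_span A v -> linear_span A (k *: u + v).
Proof.
move=> [m [c [a [Aa ->]]]] [n [d [b [Ab ->]]]].
pose join T (f : 'I_m -> T) (g : 'I_n -> T) (i : 'I_(m + n)) :=
  match fintype.split i with inl j => f j | inr j => g j end.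
exists (m + n)%N, (join _ (fun j => k * c j) d), (join _ a b); split.
  by move=> i; rewrite /join; case: fintype.split.
rewrite big_split_ord scaler_sumr; congr (_ + _); apply: eq_bigr => i _.
  by rewrite /join (unsplitK (inl i)) scalerA.
by rewrite /join (unsplitK (inr i)).
Qed.

End wedges.

Section ordered_normed_spaces.
Context {R : realType} {X : normedModType R}.
Implicit Type P : set X.

Definition ordered_normed_space P := is_cone P /\ closed P.

Definition total_cone P := dense (linear_span P).

Definition normal_cone P :=
  exists2 C : R, 0 < C &
  forall x1 x2, wedge_le P 0 x1 -> wedge_le P x1 x2 -> `|x1| <= C * `|x2|.

End ordered_normed_spaces.

Section bounded_operators.
Context {R : realType} (X Y : normedModType R).

Definition bounded_linear : {pred X -> Y} :=
  mem [set f : X -> Y |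
    linear f /\ exists M : R, forall x, `|f x| <= M * `|x|].

Record bounded_op := BoundedOp { bounded_op_fun :> X -> Y ; bounded_opP : bounded_op_fun \in bounded_linear }.

HB.instance Definition _ := [isSub for bounded_op_fun].
HB.instance Definition _ := [Choice of bounded_op by <:].

Lemma bounded_linear_submod : submod_closed bounded_linear.
Proof.
split; first apply/mem_set; first split.
- by move=> a u v; rewrite /= scaler0 addr0.
- by exists 0 => x; rewrite normr0 mul0r.
move=> a f g /set_mem[lf [M fM]] /set_mem[lg [N gN]]; apply/mem_set; split.
  move=> b u v; rewrite !fctE lf lg !scalerDr !scalerA (mulrC b a).
  by rewrite addrACA.
exists (`|a| * M + N) => x; rewrite !fctE mulrDl (le_trans (ler_normD _ _))//.
by rewrite lerD// normrZ -mulrA ler_wpM2l.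
Qed.

HB.instance Definition _ :=
  GRing.isSubmodClosed.Build R (X -> Y) bounded_linear bounded_linear_submod.
HB.instance Definition _ := [SubChoice_isSubLmodule of bounded_op by <:].

Lemma bounded_op_linear (f : bounded_op) : linear f.
Proof. by case: f => f /= /set_mem[]. Qed.

HB.instance Definition _ (f : bounded_op) :=
  GRing.isLinear.Build R X Y *:%R (bounded_op_fun f) (bounded_op_linear f).

Lemma bounded_op_bounded (f : bounded_op) : exists M : R, forall x, `|f x| <= M * `|x|.
Proof. by case: f => f /= /set_mem[]. Qed.

Definition op_norm (f : bounded_op) : R := sup [set `|f x| | x in [set x | `|x| <= 1]].

Let op_norm_has_sup (f : bounded_op) : has_sup [set `|f x| | x in [set x | `|x| <= 1]].
Proof.
split; first by exists `|f 0|, 0 => //=; rewrite normr0.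
have [M fM] := bounded_op_bounded f; exists `|M| => _ [x /= x1 <-].
rewrite (le_trans (fM x))// (le_trans (ler_norm _))// normrM normr_id.
exact: ler_piMr.
Qed.

Lemma ler_op_norm (f : bounded_op) x : `|f x| <= op_norm f * `|x|.
Proof.
have [->|x0] := eqVneq x 0; first by rewrite linear0 !normr0 mulr0.
have nx0 : 0 < `|x| by rewrite normr_gt0.
rewrite -ler_pdivrMr// mulrC -[X in X * _]ger0_norm ?invr_ge0//.
rewrite -normrZ -linearZ /=; apply: sup_upper_bound => //.
exists (`|x|^-1 *: x) => //=.
by rewrite normrZ normfV normr_id mulVf// gt_eqF.
Qed.

Lemma op_norm_le (f : bounded_op) (M : R) :
  0 <= M -> (forall x, `|f x| <= M * `|x|) -> op_norm f <= M.
Proof.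
move=> M0 fM; apply: ge_sup; first by have [] := op_norm_has_sup f.
by move=> _ [x /= x1 <-]; rewrite (le_trans (fM x))// ler_piMr.
Qed.

Lemma op_norm_ge0 (f : bounded_op) : 0 <= op_norm f.
Proof.
apply: sup_upper_bound => //; exists 0; last by rewrite linear0 normr0.
by rewrite /= normr0.
Qed.

Let op_normD (f g : bounded_op) : op_norm (f + g) <= op_norm f + op_norm g.
Proof.
apply: op_norm_le => [|x]; first by rewrite addr_ge0 ?op_norm_ge0.
rewrite mulrDl (le_trans (ler_normD (f x) (g x)))//.
by rewrite lerD// ler_op_norm.
Qed.

Let op_normZ (a : R) (f : bounded_op) : op_norm (a *: f) = `|a| * op_norm f.
Proof.
have le_normZ b (g : bounded_op) : op_norm (b *: g) <= `|b| * op_norm g.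
  apply: op_norm_le => [|x]; first by rewrite mulr_ge0 ?op_norm_ge0.
  rewrite -[X in `|X|]/(b *: g x) normrZ -mulrA.
  by rewrite ler_wpM2l ?ler_op_norm.
apply/eqP; rewrite eq_le le_normZ /=.
have [->|a0] := eqVneq a 0; first by rewrite normr0 mul0r op_norm_ge0.
rewrite -ler_pdivlMl ?normr_gt0// -normfV.
by rewrite -{1}[f](scalerK a0) le_normZ.
Qed.

Let op_norm_eq0 (f : bounded_op) : op_norm f = 0 -> f = 0.
Proof.
move=> f0; apply/val_inj/funext => x; apply/eqP.
by rewrite -normr_le0 -(mul0r `|x|) -f0 ler_op_norm.
Qed.

HB.instance Definition _ :=
  Lmodule_isNormed.Build R bounded_op op_normD op_normZ op_norm_eq0.

Lemma op_normE (f : bounded_op) : `|f| = op_norm f. Proof. by []. Qed.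

End bounded_operators.

Arguments bounded_linear {R} X Y.
Arguments bounded_op {R} X Y.

Section approximable_operators.
Context {R : realType} (X Y : normedModType R).

(* A bounded operator has finite rank iff finitely many vectors span a subspace
   containing its range. *)
Definition finite_rank : set (bounded_op X Y) :=
  [set T | exists2 A : set Y, finite_set A & range T `<=` linear_span A].

Let finite_rank0 : finite_rank 0.
Proof. by exists set0 => // _ [x _ <-]; exact: linear_span0. Qed.

Let finite_rankP (a : R) (S T : bounded_op X Y) :
  finite_rank S -> finite_rank T -> finite_rank (a *: S + T).
Proof.
move=> [A fA SA] [B fB TB]; exists (A `|` B); first by rewrite finite_setU.
move=> _ [x _ <-]; rewrite -[X in linear_span _ X]/(a *: S x + T x).
apply: linear_spanP.
  by apply: (linear_spanS (@subsetUl _ A B)); apply: SA; exists x.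
by apply: (linear_spanS (@subsetUr _ A B)); apply: TB; exists x.
Qed.

Definition approximable : {pred bounded_op X Y} := mem (closure finite_rank).

Lemma approximableP (T : bounded_op X Y) : T \in approximable <->
  forall e : R, 0 < e -> exists2 S, finite_rank S & `|T - S| < e.
Proof.
split=> [/set_mem cT e e0|eT].
  by have [S [fS TS]] := cT _ (nbhsx_ballx T e e0); exists S => //; move: TS;
    rewrite -ball_normE.
apply/mem_set => B /nbhs_ballP[e /= e0 eB].
by have [S fS TS] := eT e e0; exists S; split => //; apply: eB;
  rewrite -ball_normE.
Qed.

Lemma approximable_submod : submod_closed approximable.
Proof.
split; first by apply/mem_set; exact: subset_closure.
move=> a S T /approximableP cS /approximableP cT; apply/approximableP => e e0.
have d0 : 0 < e / 2 / (`|a| + 1) by rewrite !divr_gt0// ltr_wpDl.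
have [S' fS' SS'] := cS _ d0.
have [T' fT' TT'] := cT _ (divr_gt0 e0 (ltr0n R 2)).
exists (a *: S' + T'); first exact: finite_rankP.
rewrite opprD addrACA -scalerBr (le_lt_trans (ler_normD _ _))//.
rewrite [ltRHS](splitr e) ler_ltD// normrZ.
rewrite (@le_trans _ _ ((`|a| + 1) * `|S - S'|))//.
  by rewrite ler_wpM2r// lerDl.
by rewrite mulrC -ler_pdivlMr ?ltr_wpDl// ltW.
Qed.

Record approx_op :=
  ApproxOp { approx_op_val :> bounded_op X Y ;
             approx_opP : approx_op_val \in approximable }.

HB.instance Definition _ := [isSub for approx_op_val].
HB.instance Definition _ := [Choice of approx_op by <:].
HB.instance Definition _ :=
  GRing.isSubmodClosed.Build R (bounded_op X Y) approximable
    approximable_submod.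
HB.instance Definition _ := [SubChoice_isSubLmodule of approx_op by <:].

Definition approx_op_norm (T : approx_op) : R := `|approx_op_val T|.

Let approx_op_normD (S T : approx_op) :
  approx_op_norm (S + T) <= approx_op_norm S + approx_op_norm T.
Proof. exact: (ler_normD (approx_op_val S)). Qed.

Let approx_op_normZ (a : R) (T : approx_op) :
  approx_op_norm (a *: T) = `|a| * approx_op_norm T.
Proof. exact: (normrZ a (approx_op_val T)). Qed.

Let approx_op_norm_eq0 (T : approx_op) : approx_op_norm T = 0 -> T = 0.
Proof. by move=> /normr0_eq0 T0; exact: val_inj. Qed.

HB.instance Definition _ := Lmodule_isNormed.Build R approx_op
  approx_op_normD approx_op_normZ approx_op_norm_eq0.

End approximable_operators.
Arguments approximable {R} X Y.
Arguments approx_op {R} X Y.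

Definition dual {R : realType} (X : normedModType R) : normedModType R :=
  bounded_op X R^o.

(* The values of a functional in R rather than in the regular module R^o. *)
Definition pairing {R : realType} {X : normedModType R}
  (x' : dual X) (x : X) : R := (x' : bounded_op X R^o) x.

Notation "''<' x' , x '>'" := (pairing x' x)
  (at level 0, x' at level 69, x at level 69, format "''<' x' ,  x '>'").

Section duality.
Context {R : realType}.
Implicit Types X Y : normedModType R.

Lemma pairingP X (x' : dual X) (a : R) (x y : X) :
  '<x', a *: x + y> = a * '<x', x> + '<x', y>.
Proof. exact: bounded_op_linear. Qed.

Lemma ler_pairing X (x' : dual X) (x : X) : `|'<x', x>| <= `|x'| * `|x|.
Proof. exact: ler_op_norm. Qed.

Lemma eval_bounded_linear X (x : X) :
  ((fun x' => '<x', x>) : dual X -> R^o) \in bounded_linear (dual X) R^o.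
Proof.
by apply/mem_set; split => //; exists `|x| => x'; rewrite mulrC ler_pairing.
Qed.

Definition canonical_embedding X (x : X) : dual (dual X) :=
  BoundedOp (eval_bounded_linear x).

Lemma approx_opDZ X Y (a : R) (S T : approx_op X Y) (x : X) :
  (a *: S + T) x = a *: S x + T x.
Proof. by []. Qed.

Lemma tensor_bounded_linear X Y (y' : dual Y) (x : X) :
  ((fun T => '<y', T x>) : approx_op X Y -> R^o)
    \in bounded_linear (approx_op X Y) R^o.
Proof.
apply/mem_set; split; first by move=> a S T; rewrite approx_opDZ pairingP.
exists (`|y'| * `|x|) => T; rewrite (le_trans (ler_pairing _ _))//.
by rewrite -mulrA ler_wpM2l// mulrC; exact: ler_op_norm.
Qed.

Definition tensor X Y (y' : dual Y) (x : X) : dual (approx_op X Y) :=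
  BoundedOp (tensor_bounded_linear y' x).

Definition dual_wedge X (Xp : set X) : set (dual X) :=
  [set x' | forall x, Xp x -> 0 <= '<x', x> ].

Definition positive_op X Y (Xp : set X) (Yp : set Y) : set (bounded_op X Y) :=
  [set T | T @` Xp `<=` Yp].

Definition positive_approx_op X Y (Xp : set X) (Yp : set Y) :
    set (approx_op X Y) :=
  [set T | positive_op Xp Yp T].

Lemma canonical_embeddingE X (x : X) (x' : dual X) :
  '<canonical_embedding x, x'> = '<x', x>.
Proof. by []. Qed.

Lemma tensorE X Y (y' : dual Y) (x : X) (T : approx_op X Y) :
  '<tensor y' x, T> = '<y', T x>.
Proof. by []. Qed.

Lemma tensor_ge0 X Y (Xp : set X) (Yp : set Y) (y' : dual Y) (x : X) :
  Xp x -> dual_wedge Yp y' ->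
  dual_wedge (positive_approx_op Xp Yp) (tensor y' x).
Proof. by move=> Xpx Yy' T TP; rewrite tensorE; apply/Yy'/TP; exists x. Qed.

End duality.

(* Main.v *)
Require Import Defs.
From mathcomp Require Import all_boot all_order all_algebra.
From mathcomp Require Import all_classical all_reals all_analysis.

Set Implicit Arguments.
Unset Strict Implicit.
Unset Printing Implicit Defensive.

Import Order.TTheory GRing.Theory Num.Theory.
Import numFieldNormedType.Exports.

Local Open Scope classical_set_scope.
Local Open Scope ring_scope.

(** From [tensor y' x] to its factors, an element [z] of [0, x] gives
    [tensor y' z] in [0, tensor y' x], hence [tensor y' z = a *: tensor y' x].
    Evaluating at the rank one operators [x' (.) *: y] turns this into
    [x' z = a * x' x] for every functional [x'], and functionals separate
    points.  The argument for [y'] is the same with the roles exchanged.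

    Conversely let [0 <= phi <= tensor y' x].  For [x' >= 0] the functional
    [y |-> phi (x' (.) *: y)] lies between [0] and [x' x *: y'], so it is a
    multiple of [y'] because [y'] is extremal.  Normality of [Xp] means that
    every functional is a difference of positive ones, so that the same is
    true for every [x']: there is a functional [alpha] on the dual of [X] with
    [phi (x' (.) *: y) = alpha x' * y' y] ([below_tensor_factors]).  Then
    [alpha] lies between [0] and [x] in the bidual, and extremality of [x]
    there gives [alpha = c *: x].  Thus [phi] and [c *: tensor y' x] agree on
    rank one operators, and these determine a bounded functional on the
    closure of the finite rank operators ([approx_op_dual_ext]).

    Three facts of functional analysis carry this: functionals separate
    points, the dual of a normal cone is generating, and functionals vanishing
    on rank one operators vanish.  The first two are instances of one
    sandwich theorem, [linear_sandwich], which finds a linear functional below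
    a sublinear one and above prescribed values on a wedge. *)

(** * Sublinear functionals and the sandwich theorem *)

Section sandwich.
Context {R : realType} {V : lmodType R}.
Implicit Types (p q : V -> R) (S : set (V * R^o)%type).

Definition sublinear p :=
  (forall x y, p (x + y) <= p x + p y) /\
  (forall a x, 0 <= a -> p (a *: x) <= a * p x).

Lemma sublinear0 p : sublinear p -> p 0 = 0.
Proof.
move=> [pD pZ]; apply/eqP; rewrite eq_le; apply/andP; split.
  by have := pZ 0 0 (lexx 0); rewrite scaler0 mul0r.
by have := pD 0 0; rewrite addr0 -lerBlDr subrr.
Qed.

Lemma sublinear_geN p x : sublinear p -> - p (- x) <= p x.
Proof.
move=> p_sub; rewrite lerNl -subr_ge0 opprK.
by have [pD _] := p_sub; have := pD x (- x); rewrite subrr sublinear0// addrC.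
Qed.

(** A wedge [S] of pairs [(u, r)] is a list of demands [r <= f u] on a linear
    [f <= p].  Such an [f] satisfies [f x = f (x + u) - f u <= p (x + u) - r]
    for all pairs in [S]; [lowered p S x] is the best of these bounds. *)
Definition lower_set p S (x : V) : set R :=
  [set p (x + ur.1) - ur.2 | ur in S].

Definition lowered p S (x : V) : R := inf (lower_set p S x).

Section lowered_lemmas.
Variables (p : V -> R) (S : set (V * R^o)%type).
Hypotheses (p_sub : sublinear p) (S_wedge : is_wedge S).
Hypothesis S_le : forall ur, S ur -> ur.2 <= p ur.1.

Lemma lower_set_nonempty x : lower_set p S x !=set0.
Proof. by have [[ur Sur] _] := S_wedge; exists (p (x + ur.1) - ur.2), ur. Qed.

Lemma lower_set_lbound x : lbound (lower_set p S x) (- p (- x)).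
Proof.
move=> _ [ur Sur <-]; rewrite lerBrDr addrC lerBlDr.
rewrite (le_trans (S_le Sur))//.
by have := p_sub.1 (x + ur.1) (- x); rewrite addrAC subrr add0r.
Qed.

Lemma lowered_le x ur : S ur -> lowered p S x <= p (x + ur.1) - ur.2.
Proof.
move=> Sur; apply: ge_inf; last by exists ur.
by exists (- p (- x)); exact: lower_set_lbound.
Qed.

Lemma le_lowered x c :
  (forall ur, S ur -> c <= p (x + ur.1) - ur.2) -> c <= lowered p S x.
Proof.
move=> cle; apply: lb_le_inf; first exact: lower_set_nonempty.
by move=> _ [ur Sur <-]; exact: cle.
Qed.

Lemma lowered_le_self x : lowered p S x <= p x.
Proof.
have [[ur Sur] SC] := S_wedge.
have S0 : S (0, 0).
  by have := SC 0 0 _ _ (lexx 0) (lexx 0) Sur Sur; rewrite !scale0r addr0.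
by have := lowered_le x S0; rewrite addr0 subr0.
Qed.

(** A linear [f <= lowered p S] has [- f u = f (- u) <= - r], so it meets
    every demand: lowering [p] has turned the demands into upper bounds. *)
Lemma lowered_le_opp ur : S ur -> lowered p S (- ur.1) <= - ur.2.
Proof. by move=> /(lowered_le (- ur.1)); rewrite addNr sublinear0// add0r. Qed.

Lemma lowered_sublinear : sublinear (lowered p S).
Proof.
have [[ur0 Sur0] SC] := S_wedge; split=> [x y|a x].
  rewrite -lerBlDl; apply: le_lowered => ur Sur.
  rewrite lerBlDr -lerBlDl; apply: le_lowered => vs Svs.
  have := SC 1 1 _ _ ler01 ler01 Sur Svs; rewrite !scale1r => Suv.
  rewrite lerBlDl (le_trans (lowered_le _ Suv))//=.
  rewrite [leRHS]addrACA -opprD [in leRHS](addrC ur.2) [in leLHS](addrC ur.2).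
  by rewrite lerD2r [ur.1 + _]addrC addrACA [leRHS]addrC; exact: p_sub.1.
rewrite le_eqVlt => /predU1P[<-|a0].
  by rewrite scale0r mul0r -(sublinear0 p_sub) lowered_le_self.
rewrite mulrC -ler_pdivrMr// mulrC; apply: le_lowered => ur Sur.
rewrite mulrC ler_pdivrMr// mulrC mulrBr.
have := SC a 0 _ _ (ltW a0) (lexx 0) Sur Sur; rewrite scale0r addr0 => Sa.
rewrite (le_trans (lowered_le _ Sa))//= -scalerDr lerD2r.
exact/p_sub.2/ltW.
Qed.

End lowered_lemmas.

Definition least_sublinear p :=
  sublinear p /\ forall q, sublinear q -> (forall x, q x <= p x) -> q = p.

(** Additivity is obtained by lowering [p] along the ray through [(v, p v)]:
    the result is sublinear and below [p], hence equal to [p] by minimality,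
    and this is the inequality [p x + p v <= p (x + v)]. *)
Lemma least_sublinear_linear p : least_sublinear p -> linear (p : V -> R^o).
Proof.
move=> [p_sub p_min].
have p_super x v : p x + p v <= p (x + v).
  pose S : set (V * R^o)%type := [set (t *: v, t * p v) | t in [set t | 0 <= t]].
  have S_wedge : is_wedge S.
    split; first by exists (0 *: v, 0 * p v), 0 => /=.
    move=> a b _ _ a0 b0 [s /= s0 <-] [t /= t0 <-].
    exists (a * s + b * t); first by rewrite /= addr_ge0// mulr_ge0.
    congr pair; first by rewrite /= !scalerA scalerDl.
    by rewrite mulrDl -!mulrA.
  have S_le ur : S ur -> ur.2 <= p ur.1.
    move=> [t /=]; rewrite le_eqVlt => /predU1P[<- <-|t0 <-] /=.
      by rewrite mul0r scale0r sublinear0.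
    rewrite -ler_pdivlMl//.
    have ti0 : 0 <= t^-1 by rewrite invr_ge0 ltW.
    by have := p_sub.2 _ (t *: v) ti0; rewrite scalerK// gt_eqF.
  have pS : lowered p S = p.
    apply: p_min; first exact: lowered_sublinear.
    exact: lowered_le_self.
  have S1 : S (v, p v) by exists 1; rewrite /= ?ler01// scale1r mul1r.
  by have := lowered_le p_sub S_le x S1; rewrite pS /= lerBrDr.
have pD x y : p (x + y) = p x + p y.
  by apply/eqP; rewrite eq_le p_super p_sub.1.
have pN x : p (- x) = - p x.
  by apply/eqP; rewrite -addr_eq0 -pD addNr sublinear0.
have pZ_ge0 a x : 0 <= a -> p (a *: x) = a * p x.
  move=> a0; apply/eqP; rewrite eq_le p_sub.2//= -lerN2 -mulrN -!pN -scalerN.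
  exact: p_sub.2.
move=> a x y; rewrite pD; congr (_ + _).
have [a0|/ltW a0] := leP 0 a; first exact: pZ_ge0.
by rewrite -[a]opprK scaleNr pN pZ_ge0 ?oppr_ge0// -mulNr.
Qed.

(** Zorn's lemma applies because a chain of sublinear functionals below [p] has
    a sublinear pointwise infimum, finite since [- p (- x)] bounds it below.
    For the subadditivity of the infimum, two members of the chain are replaced
    by the smaller one. *)
Lemma exists_least_sublinear p : sublinear p ->
  exists2 q, least_sublinear q & forall x, q x <= p x.
Proof.
move=> p_sub.
pose T := {q : V -> R | sublinear q /\ forall x, q x <= p x}.
pose below (s t : T) := `[< forall x, sval t x <= sval s x >].
have p0 : T by exists p; split.
have [||A A_chain|[q [q_sub qp]] q_max] := @ZL_preorder T p0 below.
- by move=> t; apply/asboolP => x.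
- move=> r s t /asboolP rs /asboolP st; apply/asboolP => x.
  exact: le_trans (st x) (rs x).
- have [[t0 At0]|A0] := pselect (A !=set0); last first.
    by exists p0 => s As; case: A0; exists s.
  pose E x : set R := [set sval t x | t in A].
  have E0 x : E x !=set0 by exists (sval t0 x), t0.
  have Elb x : has_lbound (E x).
    exists (- p (- x)) => _ [[q [q_sub qp]] _ <-] /=.
    by rewrite (le_trans _ (sublinear_geN _ q_sub))// lerN2.
  have infle t x : A t -> inf (E x) <= sval t x.
    by move=> At; apply: ge_inf => //; exists t.
  have le_infE x c : (forall t, A t -> c <= sval t x) -> c <= inf (E x).
    by move=> ct; apply: lb_le_inf => // _ [t At <-]; exact: ct.
  have inf_sub : sublinear (fun x => inf (E x)).
    split=> [x y|a x].
      rewrite -lerBlDl; apply: (le_infE) => s As.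
      rewrite lerBlDr -lerBlDl; apply: (le_infE) => t At.
      rewrite lerBlDr.
      have [/asboolP st|/asboolP ts] := A_chain _ _ As At.
        rewrite (le_trans (infle _ _ At))//.
        by rewrite (le_trans ((svalP t).1.1 x y))// lerD2l.
      rewrite (le_trans (infle _ _ As))//.
      by rewrite (le_trans ((svalP s).1.1 x y))// lerD2r.
    rewrite le_eqVlt => /predU1P[<-|a0].
      rewrite scale0r mul0r (le_trans (infle _ _ At0))//.
      by rewrite sublinear0//; exact: (svalP t0).1.
    rewrite mulrC -ler_pdivrMr//; apply: (le_infE) => t At.
    rewrite ler_pdivrMr// mulrC (le_trans (infle _ _ At))//.
    exact/(svalP t).1.2/ltW.
  have inf_le x : inf (E x) <= p x.
    by rewrite (le_trans (infle _ _ At0))//; exact: (svalP t0).2.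
  have infT : sublinear (fun x => inf (E x)) /\ forall x, inf (E x) <= p x by [].
  exists (exist _ (fun x => inf (E x)) infT) => s As; apply/asboolP => x /=.
  exact: infle.
exists q => //; split=> // r r_sub rq; apply/funext => x.
have rp y : r y <= p y by exact: le_trans (rq y) (qp y).
apply/eqP; rewrite eq_le rq /=.
pose r' : T := exist _ r (conj r_sub rp).
have /q_max /asboolP : below (exist _ q (conj q_sub qp)) r' by apply/asboolP.
exact.
Qed.

(** A Hahn-Banach theorem: lower [p] along [S], then take a minimal sublinear
    functional below the result, which is linear. *)
Lemma linear_sandwich p S : sublinear p -> is_wedge S ->
    (forall ur, S ur -> ur.2 <= p ur.1) ->
  exists f : V -> R^o, [/\ linear f, forall x, f x <= p x
                     & forall ur, S ur -> ur.2 <= f ur.1].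
Proof.
move=> p_sub S_wedge S_le.
have [f f_min fle] :=
  exists_least_sublinear (lowered_sublinear p_sub S_wedge S_le).
have f_lin := least_sublinear_linear f_min.
exists f; split=> // [x|ur Sur].
  exact: le_trans (fle x) (lowered_le_self p_sub S_wedge S_le x).
have := le_trans (fle (- ur.1)) (lowered_le_opp p_sub S_le Sur).
have -> : f (- ur.1) = - f ur.1.
  have := f_lin (-1) ur.1 0.
  by rewrite (sublinear0 f_min.1) !addr0 !scaleN1r.
by rewrite lerN2.
Qed.

End sandwich.

(** * Consequences for normed spaces and their duals *)

Section duality_tools.
Context {R : realType}.
Implicit Types X Y : normedModType R.

Lemma pairingBl X (f g : dual X) x : '<f - g, x> = '<f, x> - '<g, x>.
Proof. by []. Qed.

Lemma pairingZl X (a : R) (f : dual X) x : '<a *: f, x> = a * '<f, x>.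
Proof. by []. Qed.

Lemma pairing0 X (f : dual X) : '<f, 0> = 0.
Proof. exact: (linear0 (f : bounded_op X R^o)). Qed.

Lemma pairingB X (f : dual X) x y : '<f, x - y> = '<f, x> - '<f, y>.
Proof. exact: (linearB (f : bounded_op X R^o)). Qed.

Lemma pairingD X (f : dual X) x y : '<f, x + y> = '<f, x> + '<f, y>.
Proof. exact: (linearD (f : bounded_op X R^o)). Qed.

Lemma pairingZ X (f : dual X) (a : R) x : '<f, a *: x> = a * '<f, x>.
Proof. by have := pairingP f a x 0; rewrite pairing0 !addr0. Qed.

Lemma dual_ext X (f g : dual X) : (forall x, '<f, x> = '<g, x>) -> f = g.
Proof. by move=> fg; apply/val_inj/funext. Qed.

Lemma functional_above_wedge X (S : set (X * R^o)%type) (K : R) : 0 <= K ->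
    is_wedge S -> (forall ur, S ur -> ur.2 <= K * `|ur.1|) ->
  exists f : dual X, forall ur, S ur -> ur.2 <= '<f, ur.1>.
Proof.
move=> K0 S_wedge S_le.
have norm_sub : sublinear (fun x : X => K * `|x|).
  split=> [x y|a x a0]; first by rewrite -mulrDr ler_wpM2l ?ler_normD.
  by rewrite normrZ ger0_norm// mulrCA.
have [f [f_lin f_le f_ge]] := linear_sandwich norm_sub S_wedge S_le.
have f_bounded : f \in bounded_linear X R^o.
  apply/mem_set; split=> //; exists K => x.
  rewrite real_ler_norml ?num_real// f_le andbT lerNl.
  have -> : - f x = f (- x).
    have f0 : f 0 = 0.
      by have := f_lin (-1) 0 0; rewrite scaler0 addr0 scaleN1r addNr.
    by have := f_lin (-1) x 0; rewrite f0 !addr0 !scaleN1r.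
  by rewrite -normrN f_le.
by exists (BoundedOp f_bounded).
Qed.

(** The demand [f x >= `|x|], extended to the ray through [x], is compatible
    with the bound [f <= `|.|]. *)
Lemma dual_separates_points X (x : X) : x != 0 ->
  exists f : dual X, '<f, x> != 0.
Proof.
move=> x0.
pose S : set (X * R^o)%type := [set (t *: x, t * `|x|) | t in [set t | 0 <= t]].
have S_wedge : is_wedge S.
  split; first by exists (0 *: x, 0 * `|x|), 0 => /=.
  move=> a b _ _ a0 b0 [s /= s0 <-] [t /= t0 <-].
  exists (a * s + b * t); first by rewrite /= addr_ge0// mulr_ge0.
  congr pair; first by rewrite /= !scalerA scalerDl.
  by rewrite mulrDl -!mulrA.
have [|f f_ge] := functional_above_wedge ler01 S_wedge.
  by move=> _ [t /= t0 <-] /=; rewrite mul1r normrZ ger0_norm.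
exists f; rewrite gt_eqF//.
have S1 : S (x, `|x|) by exists 1; rewrite /= ?ler01// scale1r mul1r.
by rewrite (lt_le_trans _ (f_ge _ S1))//= normr_gt0.
Qed.

(** The dual wedge of a normal cone is generating: [x'] is the difference of
    the positive functionals [f] and [f - x'].  The two conditions on [f] are
    the demands [f z >= x' z] and [f w >= 0], for [z], [w] in [Xp]; together
    they ask that [f (z + w) >= x' z], and normality provides the bound
    [x' z <= `|x'| * C * `|z + w|] that makes this compatible with
    continuity. *)
Lemma normal_cone_dual_dominated X (Xp : set X) (x' : dual X) :
    is_wedge Xp -> normal_cone Xp ->
  exists2 f, dual_wedge Xp f & dual_wedge Xp (f - x').
Proof.
move=> Xp_wedge [C C0 Xp_normal].
have [[z0 Xz0] XpC] := Xp_wedge.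
have Xp0 : Xp 0.
  by have := XpC 0 0 _ _ (lexx 0) (lexx 0) Xz0 Xz0; rewrite !scale0r addr0.
pose S : set (X * R^o)%type :=
  [set ur | exists z w, [/\ Xp z, Xp w & ur = (z + w, '<x', z>)]].
have S_wedge : is_wedge S.
  split; first by exists (0 + 0, '<x', 0>), 0, 0.
  move=> a b _ _ a0 b0 [z [w [Xz Xw ->]]] [t [u [Xt Xu ->]]].
  exists (a *: z + b *: t), (a *: w + b *: u); split; [exact: XpC..|].
  congr pair; last by rewrite pairingD !pairingZ.
  by rewrite /= !scalerDr addrACA.
have [||f f_ge] := @functional_above_wedge X S (`|x'| * C) _ S_wedge.
- by rewrite mulr_ge0// ltW.
- move=> _ [z [w [Xz Xw ->]]] /=.
  rewrite (le_trans (ler_norm _))// (le_trans (ler_pairing _ _))//.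
  rewrite -mulrA ler_wpM2l//; apply: Xp_normal; first by rewrite /wedge_le subr0.
  by rewrite /wedge_le addrAC subrr add0r.
exists f => x Xx.
  have Sx : S (x, 0) by exists 0, x; split=> //; rewrite add0r pairing0.
  exact: f_ge Sx.
have Sx : S (x, '<x', x>) by exists x, 0; split=> //; rewrite addr0.
by rewrite pairingBl subr_ge0; exact: f_ge Sx.
Qed.

Lemma pairing_eq0_approx X (f : dual X) x :
    (forall e : R, 0 < e -> exists2 s, '<f, s> = 0 & `|x - s| < e) ->
  '<f, x> = 0.
Proof.
move=> approx; apply/eqP; rewrite -normr_le0; apply/ler_addgt0Pl => e e0.
have d0 : 0 < e / (`|f| + 1) by rewrite divr_gt0// ltr_wpDl.
have [s fs /ltW xs] := approx _ d0.
rewrite addr0 -[x](subrK s) pairingD fs addr0 (le_trans (ler_pairing _ _))//.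
rewrite (@le_trans _ _ ((`|f| + 1) * `|x - s|)) ?ler_wpM2r ?lerDl//.
by rewrite mulrC -ler_pdivlMr// ltr_wpDl.
Qed.

Lemma total_cone_eq0 X (Xp : set X) (f : dual X) :
  total_cone Xp -> (forall x, Xp x -> '<f, x> = 0) -> f = 0.
Proof.
move=> Xp_total f0; apply: dual_ext => x; apply: pairing_eq0_approx => e e0.
have [|s [xs [n [c [a [Xa sE]]]]]] := Xp_total (ball x e) _ (ball_open x e).
  by exists x; exact: ballxx.
exists s; last by move: xs; rewrite -ball_normE.
rewrite sE; elim/big_rec: _ => [|i z _ fz0]; first exact: pairing0.
by rewrite pairingP f0// mulr0 add0r.
Qed.

End duality_tools.

(** * Rank one operators *)

Section rank_one_operators.
Context {R : realType} {X Y : normedModType R}.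

Lemma rank_one_bounded_linear (x' : dual X) (y : Y) :
  ((fun x => '<x', x> *: y) : X -> Y) \in bounded_linear X Y.
Proof.
apply/mem_set; split; first by move=> a u v; rewrite pairingP scalerDl scalerA.
exists (`|x'| * `|y|) => x; rewrite normrZ mulrAC ler_wpM2r//.
exact: ler_pairing.
Qed.

Lemma rank_one_approximable (x' : dual X) (y : Y) :
  BoundedOp (rank_one_bounded_linear x' y) \in approximable X Y.
Proof.
apply/mem_set/subset_closure; exists [set y]; first exact: finite_set1.
move=> _ [x _ <-]; exists 1%N, (fun=> '<x', x>), (fun=> y); split=> //.
by rewrite big_ord1.
Qed.

Definition rank_one (x' : dual X) (y : Y) : approx_op X Y :=
  ApproxOp (rank_one_approximable x' y).

Lemma rank_oneE (x' : dual X) (y : Y) (x : X) :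
  rank_one x' y x = '<x', x> *: y.
Proof. by []. Qed.

Lemma approx_op_ext (S T : approx_op X Y) : (forall x, S x = T x) -> S = T.
Proof. by move=> ST; apply/val_inj/val_inj/funext. Qed.

Lemma rank_oneP (a : R) (f g : dual X) (y : Y) :
  rank_one (a *: f + g) y = a *: rank_one f y + rank_one g y.
Proof.
apply: approx_op_ext => x.
by rewrite approx_opDZ !rank_oneE scalerA -scalerDl.
Qed.

Lemma rank_onePr (f : dual X) (a : R) (y z : Y) :
  rank_one f (a *: y + z) = a *: rank_one f y + rank_one f z.
Proof.
apply: approx_op_ext => x.
by rewrite approx_opDZ !rank_oneE scalerDr !scalerA mulrC.
Qed.

Lemma norm_rank_one (f : dual X) (y : Y) : `|rank_one f y| <= `|f| * `|y|.
Proof.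
apply: op_norm_le => [|x]; first by rewrite mulr_ge0.
rewrite rank_oneE normrZ mulrAC ler_wpM2r//.
exact: ler_pairing.
Qed.

Lemma positive_rank_one (Xp : set X) (Yp : set Y) (x' : dual X) (y : Y) :
  is_wedge Yp -> dual_wedge Xp x' -> Yp y ->
  positive_approx_op Xp Yp (rank_one x' y).
Proof.
move=> [_ YpC] x'_ge0 Yy _ [x Xx <-]; rewrite rank_oneE.
have := YpC '<x', x> 0 y y (x'_ge0 _ Xx) (lexx 0) Yy Yy.
by rewrite scale0r addr0.
Qed.

Lemma adjoint_bounded_linear (T : approx_op X Y) (y' : dual Y) :
  ((fun x => '<y', T x>) : X -> R^o) \in bounded_linear X R^o.
Proof.
apply/mem_set; split=> [a u v|].
  by rewrite (bounded_op_linear (approx_op_val T)) pairingP.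
exists (`|y'| * `|approx_op_val T|) => x; rewrite (le_trans (ler_pairing _ _))//.
by rewrite -mulrA ler_wpM2l//; exact: ler_op_norm.
Qed.

Definition adjoint (T : approx_op X Y) (y' : dual Y) : dual X :=
  BoundedOp (adjoint_bounded_linear T y').

Lemma linear_span_map (A B : set Y) (g : Y -> Y) v : linear g ->
  (forall a, A a -> linear_span B (g a)) ->
  linear_span A v -> linear_span B (g v).
Proof.
move=> g_lin gAB [n [c [a [Aa ->]]]].
have g0 : g 0 = 0.
  by have := g_lin (-1) 0 0; rewrite scaler0 addr0 scaleN1r addNr.
have -> : g (\sum_(i < n) c i *: a i) = \sum_(i < n) c i *: g (a i).
  elim/big_rec2: _ => // i _ z _ <-; exact: g_lin.
elim/big_rec: _ => [|i w _ Bw]; first exact: linear_span0.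
by apply: linear_spanP => //; exact: gAB.
Qed.

(** Stated so as to cover [a = 0]: subtracting [f (.) *: a] then kills [a] in
    all cases, whether or not [a] contributes to a span. *)
Lemma dual_fixes_vector (a : Y) : exists f : dual Y, '<f, a> *: a = a.
Proof.
have [->|a0] := eqVneq a 0; first by exists 0; rewrite scaler0.
have [f fa0] := dual_separates_points a0; exists ('<f, a>^-1 *: f).
by rewrite pairingZl mulVf// scale1r.
Qed.

(** A finite rank operator is a sum of rank one operators, with bounded
    functionals as coefficients.  If the range of [T] is spanned by [a :: s] and
    [f a *: a = a], then subtracting the rank one operator [f (T (.)) *: a]
    leaves an operator whose range is spanned by the vectors
    [b - f b *: a] with [b] in [s], one fewer than before. *)
Lemma eq0_finite_rank (D : dual (approx_op X Y)) (T : approx_op X Y) :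
  (forall x' y, '<D, rank_one x' y> = 0) ->
  finite_rank (approx_op_val T) -> '<D, T> = 0.
Proof.
move=> D0 [A /finite_seqP[s ->]].
have [n] := ubnP (size s); elim: n => // n IHn in s T *.
case: s => [|a s] /= s_n Ts.
  have -> : T = 0; last exact: pairing0.
  apply/approx_op_ext => x.
  have [m [c [b [+ Tx]]]] : linear_span [set` [::]] (T x) by apply: Ts; exists x.
  by case: m c b Tx => [|m] c b Tx => [_|/(_ ord0)//]; rewrite Tx big_ord0.
have [f fa] := dual_fixes_vector a.
pose T' := T - rank_one (adjoint T f) a.
have T'E x : T' x = T x - '<f, T x> *: a by [].
have T'D : T = T' + rank_one (adjoint T f) a by rewrite subrK.
rewrite T'D pairingD D0 addr0.
have key v : linear_span [set` a :: s] v ->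
    linear_span [set` [seq b - '<f, b> *: a | b <- s]] (v - '<f, v> *: a).
  apply: (linear_span_map (g := fun v => v - '<f, v> *: a)) => [k u w|b /=].
    by rewrite pairingP scalerBr scalerDl -scalerA opprD addrACA.
  rewrite inE => /predU1P[->|bs]; first by rewrite fa subrr; exact: linear_span0.
  exists 1%N, (fun=> 1), (fun=> b - '<f, b> *: a); split=> [_ /=|].
    exact: map_f.
  by rewrite big_ord1 scale1r.
apply: (IHn [seq b - '<f, b> *: a | b <- s]); first by rewrite size_map.
move=> _ [x _ <-]; rewrite -[X in linear_span _ X]/(T x - '<f, T x> *: a).
by apply/key/Ts; exists x.
Qed.

End rank_one_operators.

(** Rank one operators span a dense subspace of the approximable operators. *)
Lemma approx_op_dual_ext {R : realType} {X Y : normedModType R}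
    (D E : dual (approx_op X Y)) :
  (forall x' y, '<D, rank_one x' y> = '<E, rank_one x' y>) -> D = E.
Proof.
move=> DE; apply: dual_ext => T; apply/eqP; rewrite -subr_eq0 -pairingBl.
apply/eqP/pairing_eq0_approx => e e0.
have [S S_finite TS] := (approximableP _).1 (approx_opP T) e e0.
have Sapprox : S \in approximable X Y by exact/mem_set/subset_closure.
exists (ApproxOp Sapprox) => //; apply: eq0_finite_rank => // x' y.
by rewrite pairingBl DE subrr.
Qed.

(** When [s = 0], extremality says nothing about [g]; then [g] vanishes on [Yp]
    and totality of [Yp] is what forces [g = 0]. *)
Lemma extremal_dual_scaled {R : realType} {Y : normedModType R} (Yp : set Y)
    (y' g : dual Y) (s : R) : total_cone Yp ->
  extremal (dual_wedge Yp) y' -> 0 <= s -> dual_wedge Yp g ->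
  dual_wedge Yp (s *: y' - g) -> exists a : R, g = a *: y'.
Proof.
move=> Yp_total [y'_ge0 y'_ext] s0 g_ge0 g_le.
have [s_eq0|s_neq0] := eqVneq s 0.
  exists 0; rewrite scale0r; apply: (total_cone_eq0 Yp_total) => y Yy.
  have := g_le y Yy; rewrite s_eq0 pairingBl pairingZl mul0r sub0r oppr_ge0.
  by move=> gy0; apply/eqP; rewrite eq_le gy0 g_ge0.
have si0 : 0 <= s^-1 by rewrite invr_ge0.
have [|a ga] := y'_ext (s^-1 *: g).
  split=> y Yy; first by rewrite subr0 pairingZl mulr_ge0// g_ge0.
  rewrite pairingBl pairingZl; have := mulr_ge0 si0 (g_le y Yy).
  by rewrite pairingBl pairingZl mulrBr mulKf.
by exists (s * a); rewrite -scalerA -ga scalerA divff// scale1r.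
Qed.

(** * Extremality of tensors *)

Section tensor_extremality.
Context {R : realType} {X Y : normedModType R} (Xp : set X) (Yp : set Y).
Local Notation Cp := (dual_wedge (positive_approx_op Xp Yp)).

Lemma tensor_rank_one (y' : dual Y) (x : X) (x' : dual X) (y : Y) :
  '<tensor y' x, rank_one x' y> = '<x', x> * '<y', y>.
Proof. by rewrite tensorE rank_oneE pairingZ. Qed.

Lemma extremal_tensorl (y' : dual Y) (x : X) :
    y' != 0 -> Xp x -> dual_wedge Yp y' ->
  extremal Cp (tensor y' x) -> extremal Xp x.
Proof.
move=> y'_neq0 x_ge0 y'_ge0 [_ ext]; split=> // z [z_ge0 z_le].
have [|a za] := ext (tensor y' z).
  split; first by rewrite /wedge_le subr0; apply: tensor_ge0 => //;
    rewrite -[z]subr0.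
  by move=> T T_ge0; rewrite pairingBl !tensorE -pairingB -linearB;
    apply: y'_ge0; apply: T_ge0; exists (x - z).
exists a; apply/eqP; rewrite -subr_eq0; apply: contraT.
move=> /dual_separates_points[f] /negP[]; apply/eqP.
have [y y0] : exists y, '<y', y> != 0.
  apply: contrapT => y0; case/negP: y'_neq0; apply/eqP/dual_ext => y.
  by apply/eqP; apply: contraT => yn0; case: y0; exists y.
have : '<tensor y' z, rank_one f y> = '<a *: tensor y' x, rank_one f y>.
  by rewrite za.
rewrite pairingZl !tensor_rank_one mulrA => /(mulIf y0) fz.
by rewrite pairingB pairingZ fz subrr.
Qed.

Lemma extremal_tensorr (y' : dual Y) (x : X) :
    x != 0 -> Xp x -> dual_wedge Yp y' ->
  extremal Cp (tensor y' x) -> extremal (dual_wedge Yp) y'.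
Proof.
move=> x_neq0 x_ge0 y'_ge0 [_ ext]; split=> // z' [z'_ge0 z'_le].
have [|a za] := ext (tensor z' x).
  split; first by rewrite /wedge_le subr0; apply: tensor_ge0 => //;
    rewrite -[z']subr0.
  by move=> T T_ge0; rewrite pairingBl !tensorE -pairingBl; apply: z'_le;
    apply: T_ge0; exists x.
have [f fx0] := dual_separates_points x_neq0.
exists a; apply: dual_ext => y.
have : '<tensor z' x, rank_one f y> = '<a *: tensor y' x, rank_one f y>.
  by rewrite za.
by rewrite !pairingZl !tensor_rank_one mulrCA => /(mulfI fx0).
Qed.

(** The vector [y0] normalizes the proportionality constant: the multiple of
    [y'] given by [x'] is read off by evaluation at [y0]. *)
Lemma below_tensor_factors (phi : dual (approx_op X Y)) (y' : dual Y) (x : X) :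
    is_wedge Xp -> is_wedge Yp -> normal_cone Xp -> total_cone Yp ->
    Xp x -> extremal (dual_wedge Yp) y' -> Cp phi -> Cp (tensor y' x - phi) ->
  forall y0, '<y', y0> = 1 -> forall x' y,
    '<phi, rank_one x' y> = '<phi, rank_one x' y0> * '<y', y>.
Proof.
move=> Xp_wedge Yp_wedge Xp_normal Yp_total x_ge0 y'_ext phi_ge0 phi_le y0 y01.
have factors_ge0 x' y : dual_wedge Xp x' ->
    '<phi, rank_one x' y> = '<phi, rank_one x' y0> * '<y', y>.
  move=> x'_ge0.
  have g_bounded : ((fun y => '<phi, rank_one x' y>) : Y -> R^o)
      \in bounded_linear Y R^o.
    apply/mem_set; split=> [a u v|]; first by rewrite rank_onePr pairingP.
    exists (`|phi| * `|x'|) => u; rewrite (le_trans (ler_pairing _ _))//.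
    by rewrite -mulrA ler_wpM2l ?norm_rank_one.
  pose g : dual Y := BoundedOp g_bounded.
  have gE u : '<g, u> = '<phi, rank_one x' u> by [].
  have [|||a ga] :=
      @extremal_dual_scaled R Y Yp y' g '<x', x> Yp_total y'_ext.
  - exact: x'_ge0.
  - by move=> u Yu; rewrite gE; apply/phi_ge0; exact: positive_rank_one.
  - move=> u Yu; rewrite pairingBl pairingZl gE -tensor_rank_one -pairingBl.
    apply: (phi_le); exact: positive_rank_one.
  by rewrite -!gE ga !pairingZl y01 mulr1.
move=> x' y.
have [f f_ge0 fx'_ge0] := normal_cone_dual_dominated x' Xp_wedge Xp_normal.
have -> : x' = (-1) *: (f - x') + f by rewrite scaleN1r opprB subrK.
rewrite !rank_oneP !pairingP (factors_ge0 f)// (factors_ge0 (f - x'))//.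
by rewrite mulrDl mulrA.
Qed.

(** The normalizing vector [y0] is taken in [Yp], which makes
    [alpha = phi (rank_one (.) y0)] positive and bounded above by [x]. *)
Lemma tensor_extremal (y' : dual Y) (x : X) :
    is_wedge Xp -> is_wedge Yp -> normal_cone Xp -> total_cone Yp ->
    Xp x -> y' != 0 ->
    extremal (dual_wedge (dual_wedge Xp)) (canonical_embedding x) ->
    extremal (dual_wedge Yp) y' ->
  extremal Cp (tensor y' x).
Proof.
move=> Xp_wedge Yp_wedge Xp_normal Yp_total x_ge0 y'_neq0 [_ x_ext] y'_ext.
have y'_ge0 := y'_ext.1.
split=> [|phi [phi_ge0 phi_le]]; first exact: tensor_ge0.
rewrite /wedge_le subr0 in phi_ge0.
have [y0 Yy0 y01] : exists2 y0, Yp y0 & '<y', y0> = 1.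
  have [y Yy y_neq0] : exists2 y, Yp y & '<y', y> != 0.
    apply: contrapT => y0; case/negP: y'_neq0; apply/eqP.
    apply: (total_cone_eq0 Yp_total) => y Yy.
    by apply/eqP; apply: contraT => yn0; case: y0; exists y.
  exists ('<y', y>^-1 *: y); last by rewrite pairingZ mulVf.
  have := Yp_wedge.2 ('<y', y>^-1) 0 y y _ (lexx 0) Yy Yy.
  by rewrite scale0r addr0 invr_ge0; apply; exact: y'_ge0.
have phiE := below_tensor_factors Xp_wedge Yp_wedge Xp_normal Yp_total x_ge0
  y'_ext phi_ge0 phi_le y01.
have alpha_bounded : ((fun x' => '<phi, rank_one x' y0>) : dual X -> R^o)
    \in bounded_linear (dual X) R^o.
  apply/mem_set; split=> [a u v|]; first by rewrite rank_oneP pairingP.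
  exists (`|phi| * `|y0|) => u; rewrite (le_trans (ler_pairing _ _))//.
  by rewrite -mulrA ler_wpM2l// mulrC norm_rank_one.
pose alpha : dual (dual X) := BoundedOp alpha_bounded.
have alphaE u : '<alpha, u> = '<phi, rank_one u y0> by [].
have [|c alphac] := x_ext alpha.
  split=> u u_ge0.
    by rewrite subr0 alphaE; apply/phi_ge0; exact: positive_rank_one.
  rewrite pairingBl canonical_embeddingE alphaE -[X in X - _]mulr1 -y01.
  by rewrite -tensor_rank_one -pairingBl; apply/phi_le; exact: positive_rank_one.
exists c; apply: approx_op_dual_ext => x' y.
rewrite phiE -alphaE alphac !pairingZl canonical_embeddingE tensor_rank_one.
by rewrite mulrA.
Qed.

End tensor_extremality.

Theorem theorem5p1 (R : realType) (X Y : normedModType R)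
    (Xp : set X) (Yp : set Y)
    (X_ordered : ordered_normed_space Xp)
    (Y_ordered : ordered_normed_space Yp)
    (Xp_total : total_cone Xp) (Xp_normal : normal_cone Xp)
    (Xp_extremal : forall x : X, extremal Xp x ->
       extremal (dual_wedge (dual_wedge Xp)) (canonical_embedding x))
    (Yp_total : total_cone Yp)
    (x : X) (y' : dual Y)
    (x_neq0 : x != 0) (x_ge0 : Xp x)
    (y'_neq0 : y' != 0) (y'_ge0 : dual_wedge Yp y') :
  extremal (dual_wedge (positive_approx_op Xp Yp)) (tensor y' x) <->
  extremal Xp x /\ extremal (dual_wedge Yp) y'.
Proof.
have [[Xp_wedge _] _] := X_ordered; have [[Yp_wedge _] _] := Y_ordered.
split=> [ext|[x_ext y'_ext]].
  split; first exact: extremal_tensorl ext.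
  exact: extremal_tensorr ext.
by apply: tensor_extremal => //; exact: Xp_extremal.
Qed.
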